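(* Let $\mathfrak{V}_{<\infty}=\{r\in\mathbb{R}: VCdim(r)<\infty\}$. In the standard topology on $\mathbb{R}$: (1) $\mathfrak{V}_{<\infty}$ is not closed; (2) $\mathfrak{V}_{<\infty}$ is not open; (3) $\mathfrak{V}_{<\infty}$ is dense and codense in $\mathbb{R}$; (4) $\mathfrak{V}_{<\infty}$ is uncountable and its complement in $\mathbb{R}$ is uncountable; (5) $\mathfrak{V}_{<\infty}$ has Lebesgue measure $0$; (6) $\mathfrak{V}_{<\infty}$ is meagre.
   Context: Binary strings are indexed from $0$. For a finite binary string $s$, let $n(s)=\{i: s_i=1\}\subseteq\mathbb{N}$ (indices taken relative to $s$). For a (finite or right-infinite) binary string $S$, let $\mathfrak{S}=\{n(s): s \text{ a finite contiguous substring of } S\}$ (including the empty substring). A set $B\subseteq\mathbb{N}$ is shattered by $\mathfrak{S}$ if $\{c\cap B: c\in\mathfrak{S}\}$ is the full power set of $B$; $VCdim(S)$ is the largest size of a shattered set ($\infty$ if there is no largest). For a real number $r$, $VCdim(r)$ is the VC dimension of the binary string given by the base-2 representation of $r$, where for numbers with two representations the one ending in infinitely many zeros is chosen, and any binary point or negative sign is ignored. *)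

(* Defs.v *)
From HB Require Import structures.
From mathcomp Require Import all_boot all_order all_algebra.
From mathcomp Require Import all_classical all_reals all_analysis.

Set Implicit Arguments.
Unset Strict Implicit.
Unset Printing Implicit Defensive.

Import Order.TTheory GRing.Theory Num.Theory.
Import numFieldNormedType.Exports.

Local Open Scope classical_set_scope.
Local Open Scope ring_scope.

Definition ones (s : seq bool) : set nat := [set i | nth false s i].

(* [substring S p l] is the string S_p S_(p+1) ... S_(p+l-1). *)
Definition substring (S : nat -> bool) (p l : nat) : seq bool :=
  mkseq (fun j => S (p + j)%N) l.

Definition concepts (S : nat -> bool) : set (set nat) :=
  [set c | exists p l : nat, c = ones (substring S p l)].

Definition shattered (C : set (set nat)) (B : set nat) : Prop :=
  [set c `&` B | c in C] = [set A | A `<=` B].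

Definition shattered_size (C : set (set nat)) (d : nat) : Prop :=
  exists B : set nat, (B #= `I_d)%card /\ shattered C B.

(* The largest size of a shattered set, +oo if there is no largest one. *)
Definition VCdim (R : realType) (S : nat -> bool) : \bar R :=
  xget +oo%E [set (d%:R)%:E | d in
    [set d : nat | shattered_size (concepts S) d /\
                   forall e : nat, shattered_size (concepts S) e -> (e <= d)%N]].

(* The integer part of |r| has [(lead_exp r).+1] binary digits; it is written
   without leading zeros, the integer part 0 being written as one digit 0. *)
Definition lead_exp (R : realType) (r : R) : nat :=
  trunc_log 2 (Num.truncn `|r|).

(* The i-th digit of |r|, counted from the left, binary point ignored, is the
   one of weight 2 ^ (lead_exp r - i).  Taking the parity of a floor selects,
   when |r| has two expansions, the one ending in zeros; see [base2P]. *)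
Definition base2 (R : realType) (r : R) (i : nat) : bool :=
  odd (Num.truncn (`|r| * 2 ^+ i / 2 ^+ lead_exp r)).

Lemma truncn_double (R : realType) (y : R) : 0 <= y ->
  Num.truncn (y * 2) = ((Num.truncn y).*2 + odd (Num.truncn (y * 2)))%N.
Proof.
move=> y0; have y20 : 0 <= y * 2 by rewrite mulr_ge0.
suff -> : Num.truncn y = (Num.truncn (y * 2))./2.
  by rewrite addnC odd_double_half.
have /andP[y1 y2] := truncn_itv y20.
apply: truncn_def; set m := Num.truncn (y * 2) in y1 y2 *.
have e : m = (odd m + m./2.*2)%N by rewrite odd_double_half.
apply/andP; split.
  rewrite -(@ler_pM2r _ 2)// (le_trans _ y1)// -natrM muln2 ler_nat.
  by rewrite [leqRHS]e leq_addl.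
rewrite -(@ltr_pM2r _ 2)// (lt_le_trans y2)// -natrM muln2 ler_nat.
by rewrite [in leqLHS]e; case: (odd m); rewrite doubleS ?ltnS.
Qed.

Lemma truncn_lead (R : realType) (r : R) :
  Num.truncn (`|r| / 2 ^+ lead_exp r) = ((0 < Num.truncn `|r|)%N : nat).
Proof.
have /andP[r1 r2] := truncn_itv (normr_ge0 r).
rewrite /lead_exp; case: posnP => [N0|N0] /=.
  by rewrite N0 trunc_log0 expr0 divr1.
have /andP[l1 l2] := trunc_log_bounds (isT : (1 < 2)%N) N0.
apply: truncn_def; rewrite ler_pdivlMr ?exprn_gt0// ltr_pdivrMr ?exprn_gt0//.
rewrite mul1r -exprS -!natrX; apply/andP; split.
  by rewrite (le_trans _ r1)// ler_nat.
by rewrite (lt_le_trans r2)// ler_nat.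
Qed.

Lemma base2_partial (R : realType) (r : R) (n : nat) :
  (Num.truncn (`|r| * 2 ^+ n / 2 ^+ lead_exp r))%:R * 2 ^+ lead_exp r / 2 ^+ n
  = \sum_(0 <= i < n.+1) (base2 r i)%:R * 2 ^+ lead_exp r / 2 ^+ i :> R.
Proof.
elim: n => [|n IH].
  rewrite big_nat1 /base2 !expr0 !mulr1 truncn_lead.
  by case: (0 < _)%N.
rewrite big_nat_recr//= -IH /base2.
have -> : `|r| * 2 ^+ n.+1 / 2 ^+ lead_exp r =
          `|r| * 2 ^+ n / 2 ^+ lead_exp r * 2.
  by rewrite exprSr mulrA mulrAC.
rewrite {1}truncn_double; last by rewrite divr_ge0 ?mulr_ge0 ?exprn_ge0.
rewrite natrD -muln2 natrM 2!mulrDl; congr (_ + _).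
by rewrite exprSr invfM mulrA -!mulrA; congr (_ * _); rewrite mulrCA;
  congr (_ * _); rewrite mulrC -mulrA mulVf// mulr1.
Qed.

Lemma base2P (R : realType) (r : R) :
  [/\ series (fun i => (base2 r i)%:R * 2 ^+ lead_exp r / 2 ^+ i : R) @ \oo
        --> `|r|,
      ((0 < lead_exp r)%N -> base2 r 0) &
      forall n, exists2 i, (n <= i)%N & ~~ base2 r i].
Proof.
set K : R := 2 ^+ lead_exp r; have K0 : 0 < K by rewrite exprn_gt0.
have bnd n : let s := \sum_(0 <= i < n.+1) (base2 r i)%:R * K / 2 ^+ i in
    s <= `|r| < s + K / 2 ^+ n.
  rewrite /= -base2_partial -/K.
  have P : 0 < 2 ^+ n :> R by rewrite exprn_gt0.
  have /truncn_itv/andP[a b] : 0 <= `|r| * 2 ^+ n / K.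
    by rewrite divr_ge0 ?mulr_ge0 ?exprn_ge0 ?(ltW K0).
  rewrite ler_pdivrMr// -ler_pdivlMr// a/= -mulrDl -{3}[K]mul1r.
  by rewrite -mulrDl natr1 ltr_pdivlMr// -ltr_pdivrMr.
have half0 : (fun n => K / 2 ^+ n) @ \oo --> (0 : R).
  have := @cvg_geometric R K 2^-1; rewrite /geometric/=.
  under eq_fun do rewrite exprVn.
  by apply; rewrite ger0_norm// invf_lt1// ltr1n.
split.
- rewrite -(cvg_shiftS (series _)).
  apply: (@squeeze_cvgr _ _ _ _ (fun n => `|r| - K / 2 ^+ n) (cst `|r|)).
  + near=> n; have /andP[a b] := bnd n.
    by rewrite /series/= a lerBlDr ltW.
  + by rewrite -[X in _ --> X]subr0; apply: cvgB => //; exact: cvg_cst.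
  + exact: cvg_cst.
- rewrite /base2 expr0 mulr1 truncn_lead => l0.
  suff -> : (0 < Num.truncn `|r|)%N by [].
  by move: l0; rewrite /lead_exp; case: Num.truncn => //; rewrite trunc_log0.
- move=> n; apply: contrapT => H.
  have one i : (n < i)%N -> base2 r i.
    move=> ni; apply: contrapT => /negP bi; apply: H.
    by exists i => //; exact: ltnW.
  pose s m : R := \sum_(0 <= i < m.+1) (base2 r i)%:R * K / 2 ^+ i.
  have tail m : s (n + m)%N = s n + K / 2 ^+ n - K / 2 ^+ (n + m).
    elim: m => [|m IH]; first by rewrite addn0 addrK.
    rewrite /s big_nat_recr//= -/(s _) addnS -/(s (n + m)%N) IH.
    rewrite one ?ltnS ?leq_addr// mul1r -addrA; congr (_ + _).
    rewrite exprSr invfM mulrA.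
    rewrite [X in - X + _](_ : _ = K / 2 ^+ (n + m) / 2 + K / 2 ^+ (n + m) / 2).
      by rewrite opprD addrNK.
    exact: splitr.
  have /andP[_] := bnd n; apply/negP; rewrite -leNgt -/(s n).
  apply/ler_addgt0Pl => e e0.
  have [m _ /(_ m (leqnn m)) /=] : \forall m \near \oo, K / 2 ^+ m < e.
    exact: (cvgr_lt 0 half0).
  move=> me; have /andP[a _] := bnd (n + m)%N; move: a.
  rewrite -/(s (n + m)%N) tail lerBlDr => /le_trans; apply.
  rewrite addrC lerD2r ltW// (le_lt_trans _ me)// ler_pM2l//.
  rewrite lef_pV2 ?posrE ?exprn_gt0// exprD ler_peMl ?exprn_ge0//.
  by rewrite exprn_ege1// ler1n.
Unshelve. all: by end_near.
Qed.

Definition nowhere_dense (T : topologicalType) (A : set T) : Prop :=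
  (closure A)° = set0.

Definition meagre (T : topologicalType) (A : set T) : Prop :=
  exists2 F : nat -> set T,
    forall n, nowhere_dense (F n) & A = \bigcup_n F n.

Definition finite_VCdim (R : realType) : set R :=
  [set r : R | (VCdim R (base2 r) < +oo)%E].
Arguments finite_VCdim : clear implicits.

(* Main.v *)
(** If VCdim(r) is finite then, for some q = 2^l, some value v < q never occurs
    as a base-q digit of |r| after the point: otherwise {0, ..., l-1} would be
    shattered.  For fixed q and v, such r form a Cantor-like set: dividing a
    q-adic cell into q parts, one part is lost at each step, so the set is
    nowhere dense, and it is null because (1 - 1/q)^k tends to 0.  Countably
    many of these sets cover the numbers of finite VC dimension; being null,
    these numbers have a dense and uncountable complement.

    Conversely, a dyadic rational has finitely many digits 1, hence finite VC
    dimension, which gives density.  A number whose digits 1 all sit at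
    positions that are powers of 2 has VC dimension at most 2, because distinct
    powers of 2 have distinct differences; there are uncountably many such
    numbers by a diagonal argument. *)
Require Import Defs.
From mathcomp Require Import all_boot all_order all_algebra.
From mathcomp Require Import all_classical all_reals all_analysis.
From mathcomp Require Import zify lra.

Import Order.TTheory GRing.Theory Num.Theory.
Import numFieldNormedType.Exports.

Local Open Scope classical_set_scope.
Local Open Scope ring_scope.

(** * Shattering by windows of a binary string *)

Lemma ones_substringP (S : nat -> bool) p l i :
  ones (substring S p l) i <-> (i < l)%N /\ S (p + i)%N.
Proof.
rewrite /ones /substring /=; case: (ltnP i l) => il.
  by rewrite nth_mkseq//; split=> [|[]].
by rewrite nth_default ?size_mkseq//; split=> [|[]].
Qed.

Lemma shattered_trace {C : set (set nat)} {B A : set nat} :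
  shattered C B -> A `<=` B -> exists2 c, C c & c `&` B = A.
Proof.
rewrite /shattered => e AB; have : [set A | A `<=` B] A by [].
by rewrite -e => -[c]; exists c.
Qed.

Lemma shattered_size0 (S : nat -> bool) : shattered_size (concepts S) 0.
Proof.
exists set0; split; first by rewrite II0.
apply/seteqP; split=> [_ [c _ <-]|A] /=; first by rewrite setI0.
rewrite subset0 => ->; exists (ones (substring S 0 0)); last by rewrite setI0.
by exists 0%N, 0%N.
Qed.

(** Size 0 is always shattered, so a bound on the sizes yields a largest one, and [xget] does not
    fall back on [+oo]. *)
Lemma finite_VCdimP (R : realType) (r : R) : finite_VCdim R r <->
  exists d, forall e, shattered_size (concepts (base2 r)) e -> (e <= d)%N.
Proof.
rewrite /finite_VCdim /VCdim /=; split.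
  by case: xgetP => [x -> [d [_ dmax] _] _|]; [exists d|rewrite ltxx].
move=> [d dmax].
have ex0 : exists e, `[< shattered_size (concepts (base2 r)) e >].
  by exists 0%N; apply/asboolP; exact: shattered_size0.
have le e : `[< shattered_size (concepts (base2 r)) e >] -> (e <= d)%N.
  by move=> /asboolP; exact: dmax.
case: (ex_maxnP ex0 le) => m /asboolP ms mmax.
case: xgetP => [x -> [n _ <-]|/(_ (m%:R)%:E)]; first by rewrite ltry.
by case; exists m => //; split => // e /asboolP /mmax.
Qed.

(** A window whose trace is all of [B] has a one at every index in [B], which forces [B] below
    [N]. *)
Lemma shattered_size_finite_support (S : nat -> bool) (N e : nat) :
  (forall i, (N <= i)%N -> ~~ S i) ->
  shattered_size (concepts S) e -> (e <= N)%N.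
Proof.
move=> S0 [B [eB shB]].
have [c [p [l ->]] cB] := shattered_trace shB (@subset_refl _ B).
have BN : B `<=` `I_N.
  move=> i; rewrite -[X in X i]cB => -[/ones_substringP[_ Si] _].
  rewrite /= ltnNge; apply/negP => Ni.
  by move: (S0 (p + i)%N); rewrite Si (leq_trans Ni (leq_addl _ _)) => /(_ isT).
rewrite -card_le_II; apply: card_le_trans (subset_card_le BN).
by rewrite (card_le_eqr eB).
Qed.

(** If one exponent [m] were strictly below the other three, [2 ^ m.+1] would divide only one side;
    this is [low]. *)
Lemma eq_expn2D (a b c d : nat) :
  (2 ^ a + 2 ^ d = 2 ^ b + 2 ^ c)%N -> a != b -> a = c.
Proof.
have low (m n p k : nat) : (m < n)%N -> (m < p)%N -> (m < k)%N ->
    (2 ^ m + 2 ^ n)%N <> (2 ^ p + 2 ^ k)%N.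
  move=> mn mp mk e.
  have dv x : (m < x)%N -> (2 ^ m.+1 %| 2 ^ x)%N by move=> ?; exact: dvdn_exp2l.
  have : (2 ^ m.+1 %| 2 ^ m + 2 ^ n)%N by rewrite e dvdn_add// dv.
  by rewrite (dvdn_addl _ (dv n mn)) dvdn_Pexp2l// ltnn.
have mono m n : (2 ^ m < 2 ^ n)%N = (m < n)%N by rewrite ltn_exp2l.
move=> e; rewrite neq_ltn => /orP[] ab.
- have cd : (c < d)%N by rewrite -mono; move: ab; rewrite -mono; lia.
  case: (ltngtP a c) => // ac; exfalso.
    by apply: (low a d b c) => //; exact: ltn_trans cd.
  by apply: (low c b a d) => //; [exact: ltn_trans ab|lia].
- have dc : (d < c)%N by rewrite -mono; move: ab; rewrite -mono; lia.
  case: (ltngtP b d) => [bd|bd|bd].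
  + by exfalso; apply: (low b c a d) => //; exact: ltn_trans dc.
  + by exfalso; apply: (low d a b c) => //; [exact: ltn_trans ab|lia].
  + by move: e; rewrite bd addnC => /addnI /eqP; rewrite eqn_exp2l// => /eqP.
Qed.

(* A pair of ones at a given distance determines its position, so two windows
   with ones at y and z coincide, hence cannot differ at x. *)
Lemma shattered_size_powers2 (S : nat -> bool) (e : nat) :
  (forall i, S i -> exists k, i = (2 ^ k)%N) ->
  shattered_size (concepts S) e -> (e <= 2)%N.
Proof.
move=> S2 [B [eB shB]]; rewrite leqNgt; apply/negP => e3.
(* Since [x < z], a window long enough to reach [z] also covers [x]. *)
have key x y z : B x -> B y -> B z -> x != y -> y != z -> (x < z)%N -> False.
  move=> Bx By Bz xy yz xz.
  have [_ [p [l ->]] cB] := shattered_trace shB (@subset_refl _ B).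
  have pB i : B i -> S (p + i)%N.
    by rewrite -[X in X i]cB => -[/ones_substringP[]].
  have [|_ [p' [l' ->]] cyz] := @shattered_trace _ _ [set y; z] shB.
    by move=> i [] ->.
  have yz' i : [set y; z] i -> (i < l')%N /\ S (p' + i)%N.
    by rewrite -cyz => -[/ones_substringP].
  have [|yl Sy] := yz' y; first by left.
  have [|zl Sz] := yz' z; first by right.
  have pp' : p = p'.
    have [a ya] := S2 _ (pB _ By); have [b zb] := S2 _ (pB _ Bz).
    have [c yc] := S2 _ Sy; have [d zd] := S2 _ Sz.
    have ac : a = c.
      apply: (@eq_expn2D a b c d); first by lia.
      by apply: contraNneq yz => ab; move: ya; rewrite ab -zb => /addnI ->.
    by move: ya; rewrite ac -yc => /addIn.
  have : [set y; z] x.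
    rewrite -cyz; split=> //; apply/ones_substringP; split; first by lia.
    by rewrite -pp'; exact: pB.
  by move=> [] xe; move: xy xz; rewrite xe ?eqxx ?ltnn.
move: eB; rewrite card_eq_sym => /card_set_bijP[f [fB finj _]].
have ne i j : (i < e)%N -> (j < e)%N -> i != j -> f i != f j.
  move=> ie je; apply: contraNneq => fij.
  by apply/eqP; apply: finj; rewrite ?inE.
have [e0 e1] : (0 < e)%N /\ (1 < e)%N by lia.
have := ne 0%N 1%N e0 e1 isT; rewrite neq_ltn => /orP[] lt01.
- by apply: (key (f 0%N) (f 2%N) (f 1%N)) => //; try exact: fB; exact: ne.
- by apply: (key (f 1%N) (f 2%N) (f 0%N)) => //; try exact: fB; exact: ne.
Qed.

Lemma exists_bits (s : nat -> bool) (l : nat) :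
  exists v : nat, forall j, (j < l)%N -> odd (v %/ 2 ^ (l - j.+1)) = s j.
Proof.
elim: l => [|l [v vP]]; first by exists 0%N.
exists (v.*2 + s l)%N => j; rewrite ltnS leq_eqVlt => /predU1P[->|jl].
  by rewrite subnn expn0 divn1 oddD odd_double oddb.
rewrite -(vP j jl) subSS -(subnSK jl) expnS divnMA.
by congr (odd (_ %/ _)); case: (s l); lia.
Qed.

(** * Base-q digits, and nowhere density of the sets avoiding one *)

Section base_digits.
Context {R : realType}.
Implicit Types (r y : R) (q j m v : nat).

Lemma truncn_divn y q : 0 <= y -> (0 < q)%N ->
  (Num.truncn (y * q%:R) %/ q)%N = Num.truncn y.
Proof.
move=> y0 q0; have q0R : 0 < q%:R :> R by rewrite ltr0n.
have /andP[le1 lt2] := truncn_itv (mulr_ge0 y0 (ltW q0R)).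
apply/esym/truncn_def; set n := Num.truncn _ in le1 lt2 *.
rewrite -(ler_pM2r q0R) -(ltr_pM2r q0R) -!natrM.
rewrite (le_trans _ le1) ?ler_nat ?leq_divM//=.
by rewrite (lt_le_trans lt2)// ler_nat ltn_ceil.
Qed.

Lemma truncn_divnX y q (n k : nat) : 0 <= y -> (0 < q)%N ->
  (Num.truncn (y * q%:R ^+ (n + k)) %/ q ^ k)%N = Num.truncn (y * q%:R ^+ n).
Proof.
move=> y0 q0; rewrite exprD mulrA -(natrX _ q k) truncn_divn ?expn_gt0 ?q0//.
by rewrite mulr_ge0 ?exprn_ge0.
Qed.

Lemma base2_shift r (n : nat) :
  base2 r (lead_exp r + n) = odd (Num.truncn (`|r| * 2 ^+ n)).
Proof.
by rewrite /base2 exprD mulrCA mulrAC mulfV ?mul1r//.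
Qed.

(* Digit i of |r| in base q is counted from the first one after the point. *)
Definition avoid q v : set R :=
  [set r | forall i, Num.truncn (`|r| * q%:R ^+ i.+1) != v %[mod q]].

(** A digit in base [2 ^ l.+1] is a block of [l.+1] binary digits, so every pattern of that length
    appears in some window. *)
Lemma shattered_not_avoid r (l : nat) :
  (forall v, ~ avoid (2 ^ l.+1) v r) ->
  shattered_size (concepts (base2 r)) l.+1.
Proof.
move=> H; exists `I_l.+1; split=> //.
apply/seteqP; split=> [_ [c _ <-]|A AI] /=; first exact: subIsetr.
have [v vP] := exists_bits (fun j => `[< A j >]) l.+1.
have /existsNP[i /negP/negPn/eqP iv] := H v.
(* Index [lead_exp r] has weight 1; the first digit after the point comes one later, hence the
   [.+1]. *)
have digit j : (j < l.+1)%N ->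
    base2 r (lead_exp r + (i * l.+1).+1 + j)%N = `[< A j >].
  move=> jl; rewrite -addnA base2_shift -(vP j jl).
  rewrite -(@truncn_divnX _ 2 _ (l.+1 - j.+1))//.
  have -> : ((i * l.+1).+1 + j + (l.+1 - j.+1) = l.+1 * i.+1)%N by lia.
  rewrite exprM -[2 ^+ l.+1](natrX _ 2%N).
  move: iv; set N := Num.truncn _ => iv.
  have odd_mod n : odd (n %/ 2 ^ (l.+1 - j.+1)) =
      odd ((n %% 2 ^ l.+1) %/ 2 ^ (l.+1 - j.+1)).
    rewrite {1}(divn_eq n (2 ^ l.+1)).
    have -> : (2 ^ l.+1 = 2 ^ j.+1 * 2 ^ (l.+1 - j.+1))%N.
      by rewrite -expnD subnKC.
    by rewrite mulnA divnMDl ?expn_gt0// oddD oddM oddX/= andbF.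
  by rewrite odd_mod iv -odd_mod.
exists (ones (substring (base2 r) (lead_exp r + (i * l.+1).+1) l.+1)).
  by exists (lead_exp r + (i * l.+1).+1)%N, l.+1.
apply/seteqP; split=> [j [/ones_substringP[jl]]|j Aj].
  by rewrite digit// => /asboolP.
have jl : (j < l.+1)%N by exact: AI.
split=> //; apply/ones_substringP; rewrite digit//.
by split=> //; apply/asboolP.
Qed.

(* Enumerates the pairs (l, v) standing for the value v in base 2 ^ l.+1. *)
Definition forbidden (n : nat) : nat * nat := odflt (0, 0)%N (unpickle n).

Lemma finite_VCdim_avoid :
  finite_VCdim R `<=`
  \bigcup_n avoid (2 ^ (forbidden n).1.+1) (forbidden n).2.
Proof.
move=> r /finite_VCdimP[d dmax].
have /existsNP[v /contrapT rv] : ~ forall v, ~ avoid (2 ^ d.+1) v r.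
  by move=> /shattered_not_avoid /dmax; rewrite ltnn.
by exists (pickle (d, v)) => //; rewrite /forbidden pickleK.
Qed.

Lemma open_contains_cell q (U : set R) : (1 < q)%N -> open U -> U !=set0 ->
  exists (s : bool) j m, forall y,
    m%:R <= y * q%:R ^+ j <= m%:R + 1 -> U ((-1) ^+ s * y).
Proof.
move=> q1 oU [x Ux].
have [e /= e0 eU] : exists2 e : R, 0 < e & ball x e `<=` U.
  by apply/nbhs_ballP; exact: open_nbhs_nbhs.
have q0 : 0 < q%:R :> R by rewrite ltr0n ltnW.
(* With this choice [e^-1 < j < q ^ j], so a cell of level [j] is shorter than [e]. *)
pose j := (Num.truncn e^-1).+1.
have qj : 0 < q%:R ^+ j :> R by rewrite exprn_gt0.
have qe : (q%:R ^+ j)^-1 < e.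
  rewrite invf_plt ?posrE//.
  have /truncn_itv/andP[_ lt] : 0 <= e^-1 by rewrite invr_ge0 ltW.
  apply: (lt_le_trans lt); rewrite -natrX ler_nat.
  exact: ltnW (ltn_expl _ q1).
exists (x < 0)%R, j, (Num.truncn (`|x| * q%:R ^+ j)) => y /andP[my ym].
have /truncn_itv/andP[] : 0 <= `|x| * q%:R ^+ j by rewrite mulr_ge0// ltW.
set m := Num.truncn _ in my ym * => mx xm.
apply: eU; rewrite /ball /=.
have -> : x - (-1) ^+ (x < 0)%R * y = (-1) ^+ (x < 0)%R * (`|x| - y).
  by rewrite mulrBr -numEsign.
rewrite normrMsign.
apply: le_lt_trans qe; rewrite -[leRHS]mul1r ler_pdivlMr//.
rewrite -(gtr0_norm qj) -normrM mulrBl ler_norml.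
move: xm; rewrite -natr1 => xm; lra.
Qed.

Lemma nowhere_dense_avoid q v : (1 < q)%N -> nowhere_dense (avoid q v).
Proof.
move=> q1; apply: contrapT => /eqP /set0P ne.
have [s [j [m cell]]] :=
  open_contains_cell q (closure (avoid q v))° q1 (open_interior _) ne.
have q0 : 0 < q%:R :> R by rewrite ltr0n ltnW.
have qj : 0 < q%:R ^+ j :> R by rewrite exprn_gt0.
have vq : ((v %% q).+1%:R <= q%:R :> R) by rewrite ler_nat ltn_mod ltnW.
(* Midpoint of the subcell with last digit [v %% q]. Within half its width, absolute values stay in
   the subcell and keep that digit. *)
pose y : R := ((m * q + v %% q)%:R + 2^-1) / q%:R ^+ j.+1.
have /cell /interior_subset : m%:R <= y * q%:R ^+ j <= m%:R + 1.
  have -> : y * q%:R ^+ j = m%:R + ((v %% q)%:R + 2^-1) / q%:R.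
    rewrite /y exprS invfM mulrA divfK ?gt_eqF// natrD natrM -addrA mulrDl.
    by rewrite mulfK ?gt_eqF.
  rewrite lerDl lerD2l ler_pdivrMr// mul1r divr_ge0 ?addr_ge0 ?(ltW q0)//=.
  by move: vq; rewrite -(natr1 (v %% q)%N); lra.
have qj1 : 0 < q%:R ^+ j.+1 :> R by rewrite exprn_gt0.
have e0 : 0 < 2^-1 / q%:R ^+ j.+1 :> R by rewrite divr_gt0.
move=> /(_ _ (nbhsx_ballx _ _ e0)) [z [/(_ j) /eqP zv]]; apply: contra_not zv.
rewrite /ball /= => zy.
suff -> : Num.truncn (`|z| * q%:R ^+ j.+1) = (m * q + v %% q)%N.
  by rewrite modnMDl modn_mod.
apply: truncn_def.
have : `|y * q%:R ^+ j.+1 - `|z| * q%:R ^+ j.+1| < 2^-1.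
  rewrite -mulrBl normrM (gtr0_norm qj1) -ltr_pdivlMr//.
  apply: le_lt_trans zy.
  have {1}-> : y = `|(-1) ^+ s * y|.
    by rewrite normrMsign ger0_norm// divr_ge0 ?addr_ge0 ?(ltW qj1).
  exact: ler_dist_dist.
rewrite /y divfK ?gt_eqF// -(natr1 (m * q + v %% q)%N) ltr_norml; lra.
Qed.

End base_digits.

(** * Reals with prescribed binary digits *)

Section real_of_digits.
Context {R : realType}.
Implicit Type b : nat -> bool.

Fixpoint prefix_value b (n : nat) : nat :=
  if n is n'.+1 then (prefix_value b n').*2 + b n else b 0.

Lemma exists_base2 b : (forall n, exists2 i, (n <= i)%N & ~~ b i) ->
  exists r : R, base2 r =1 b.
Proof.
move=> b0; have p2 n : 0 < 2 ^+ n :> R by rewrite exprn_gt0.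
pose s n : R := (prefix_value b n)%:R / 2 ^+ n.
pose t n : R := (prefix_value b n).+1%:R / 2 ^+ n.
have step (x : R) n : x / 2 ^+ n = x * 2 / 2 ^+ n.+1.
  by rewrite exprSr invfM mulrA mulrAC mulfK.
have s_nd : {homo s : m n / (m <= n)%N >-> m <= n}.
  apply: homo_leq => [//|y x z|n]; first exact: le_trans.
  by rewrite /s step ler_pM2r ?invr_gt0// -natrM ler_nat/=; lia.
have t_ni : {homo t : m n / (m <= n)%N >-> n <= m}.
  apply: homo_leq => [//|y x z xy yz|n]; first exact: le_trans yz xy.
  rewrite /t (step _ n) ler_pM2r ?invr_gt0// -natrM ler_nat/=.
  by case: (b _); lia.
have st m n : s m <= t n.
  apply: le_trans (s_nd _ _ (leq_maxl m n)) _.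
  apply: le_trans (t_ni _ _ (leq_maxr m n)).
  by rewrite ler_pM2r ?invr_gt0// ler_nat.
pose r := sup (range s).
have sr n : s n <= r.
  by apply: ub_le_sup; [exists (t 0%N) => _ [m _ <-]|exists n].
have rt n : r <= t n by apply: ge_sup; [exists (s 0%N), 0%N|move=> _ [m _ <-]].
(* At a later zero digit the upper bounds [t] drop strictly; this excludes an expansion ending in
   ones. *)
have rt' n : r < t n.
  have [[//|k]] := b0 n.+1; rewrite ltnS => nk bk.
  apply: le_lt_trans (rt k.+1) _; apply: lt_le_trans (t_ni _ _ nk).
  rewrite /t (step _ k) ltr_pM2r ?invr_gt0// -natrM ltr_nat/= (negbTE bk).
  by lia.
have r0 : 0 <= r by apply: le_trans (sr 0%N); rewrite divr_ge0.
have tr n : Num.truncn (r * 2 ^+ n) = prefix_value b n.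
  by apply: truncn_def; rewrite -ler_pdivrMr// -ltr_pdivlMr// sr rt'.
(* The integer part is the single digit [b 0], and [trunc_log 2] is 0 at both 0 and 1. *)
have l0 : lead_exp r = 0%N.
  rewrite /lead_exp ger0_norm// -[r]mulr1 -(expr0 2) tr /=.
  by case: (b 0%N).
exists r => n; rewrite /base2 l0 ger0_norm// expr0 divr1 tr.
by case: n => [|n] /=; rewrite ?oddD ?odd_double oddb.
Qed.

End real_of_digits.

(** * Outer measure of the sets avoiding a digit *)

Section avoid_null.
Context {R : realType}.
Implicit Types (q v k j m : nat).
Local Notation mu := ((@wlength R idfun)^*)%mu.

Definition avoid_cell q v k j m : set R :=
  [set r | Num.truncn (`|r| * q%:R ^+ j) = m /\
    forall i, (i < k)%N ->
      Num.truncn (`|r| * q%:R ^+ (j + i).+1) != v %[mod q]].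

Lemma mu_itvcc (a b : R) : a <= b -> mu `[a, b]%classic = (b - a)%:E.
Proof.
move=> ab; rewrite -[LHS]/(lebesgue_measure `[a, b]%classic).
rewrite lebesgue_measure_itv/= lte_fin; case: ltP => // ba.
by rewrite (le_anti (introT andP (conj ab ba))) subrr.
Qed.

(** By induction on [k]: of the [q] subcells, the one with digit [v %% q] contributes nothing. The
    factor 2 counts the two signs of [r]. *)
Lemma mu_avoid_cell q v k j m : (0 < q)%N ->
  (mu (avoid_cell q v k j m) <= (2 * q.-1%:R ^+ k / q%:R ^+ (j + k))%:E)%E.
Proof.
move=> q0; have q0R : 0 < q%:R :> R by rewrite ltr0n.
elim: k j m => [|k IH] j m.
  have qj : 0 < q%:R ^+ j :> R by rewrite exprn_gt0.
  rewrite addn0 expr0 mulr1.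
  pose a : R := m%:R / q%:R ^+ j; pose b : R := m.+1%:R / q%:R ^+ j.
  have ab : a <= b by rewrite ler_pM2r ?invr_gt0// ler_nat.
  have ba : b - a = (q%:R ^+ j)^-1.
    by rewrite /a /b -mulrBl -natr1 addrAC subrr add0r mul1r.
  apply: (@le_trans _ _ (mu (`[a, b]%classic `|` `[- b, - a]%classic))).
    apply: le_outer_measure => r [rm _].
    have /truncn_itv/andP[] : 0 <= `|r| * q%:R ^+ j by rewrite mulr_ge0// ltW.
    rewrite rm -ler_pdivrMr// -ltr_pdivlMr// => ar rb.
    rewrite /= !in_itv/= -/a -/b in ar rb *.
    by case: (ger0P r) ar rb => r0 ar rb; [left|right]; apply/andP; split; lra.
  apply: le_trans (outer_measureU2 _ _ _) _.
  apply: (@le_trans _ _ ((b - a)%:E + (- a - - b)%:E)%E).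
    by apply: leeD; rewrite le_eqVlt; apply/orP; left; apply/eqP;
      apply: mu_itvcc; rewrite ?lerN2.
  by rewrite opprK [- a + b]addrC ba -EFinD lee_fin -mulr2n mulr_natl.
pose F i := if (i == v %% q)%N then set0 else avoid_cell q v k j.+1 (m * q + i).
apply: (@le_trans _ _ (mu (\big[setU/set0]_(i < q) F i))).
  apply: le_outer_measure => r [rm rv].
  rewrite -bigcup_mkord.
  pose n := Num.truncn (`|r| * q%:R ^+ j.+1).
  exists (n %% q)%N; first by rewrite /= ltn_mod.
  rewrite /F ifN; last by have := rv 0%N isT; rewrite addn0.
  split; last by move=> i ik; rewrite addSnnS; exact: rv.
  by rewrite -rm -(@truncn_divnX _ _ q j 1)// addn1 expn1 -/n -divn_eq.
apply: le_trans (outer_measure_subadditive _ _ _) _.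
have vq : (v %% q < q)%N by rewrite ltn_mod.
pose c : R := 2 * q.-1%:R ^+ k / q%:R ^+ (j.+1 + k).
rewrite (bigD1 (Ordinal vq))//= {1}/F eqxx outer_measure0 add0e.
apply: (@le_trans _ _ (\sum_(i < q | i != Ordinal vq) c%:E)%E).
  apply: lee_sum => i iv; rewrite /F ifN; first exact: IH.
  by apply: contra iv => /eqP e; apply/eqP/val_inj.
rewrite sumEFin lee_fin sumr_const cardC1 card_ord -(mulr_natl c) /c.
by rewrite addSnnS exprS !mulrA [_ * 2]mulrC.
Qed.

Lemma negligible_avoid q v : (1 < q)%N ->
  (@lebesgue_measure R).-negligible (avoid q v).
Proof.
move=> q1.
have cover : avoid q v `<=`
    \bigcup_m [set r : R | Num.truncn `|r| = m /\ avoid q v r].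
  by move=> r rv; exists (Num.truncn `|r|).
apply: (@negligibleS _ _ _ (@lebesgue_measure R) _ _ cover).
apply: (@negligible_bigcup _ _ _ (@lebesgue_measure R)) => m.
apply/negligible_outer_measure.
apply/eqP; rewrite eq_le outer_measure_ge0 andbT.
apply/lee_addgt0Pr => e e0; rewrite add0e.
have q0 : 0 < q%:R :> R by rewrite ltr0n ltnW.
have : (fun k => 2 * (q.-1%:R / q%:R) ^+ k) @ \oo --> (0 : R).
  apply: cvg_geometric; rewrite ger0_norm ?divr_ge0 ?(ltW q0)//.
  by rewrite ltr_pdivrMr// mul1r ltr_nat ltn_predL ltnW.
move=> /(cvgr_lt 0) /(_ e e0) [k _ /(_ k (leqnn k)) /= ke].
apply: (@le_trans _ _ (mu (avoid_cell q v k 0 m))).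
  apply: le_outer_measure => r [rm rv]; split; first by rewrite expr0 mulr1.
  by move=> i _; exact: rv.
apply: le_trans (mu_avoid_cell _ _ _ _ _ (ltnW q1)) _.
by rewrite lee_fin add0n -mulrA -exprVn -exprMn ltW.
Qed.

End avoid_null.

(** * Size of the set of reals of finite VC dimension *)

Section finite_VCdim_size.
Context {R : realType}.
Local Notation V := (finite_VCdim R).

Lemma negligible_finite_VCdim : (@lebesgue_measure R).-negligible V.
Proof.
apply: (@negligibleS _ _ _ (@lebesgue_measure R) _ _ finite_VCdim_avoid).
apply: (@negligible_bigcup _ _ _ (@lebesgue_measure R)) => n.
apply: negligible_avoid.
by rewrite -{1}(expn0 2) ltn_exp2l.
Qed.

Lemma meagre_finite_VCdim : meagre V.
Proof.
(* [meagre] asks for an equality, so the cover is cut down to [V]. *)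
exists (fun n => V `&` avoid (2 ^ (forbidden n).1.+1) (forbidden n).2).
  move=> n; have q1 : (1 < 2 ^ (forbidden n).1.+1)%N.
    by rewrite -{1}(expn0 2) ltn_exp2l.
  have nd := @nowhere_dense_avoid R _ (forbidden n).2 q1.
  apply/seteqP; split=> //; rewrite -[X in _ `<=` X]nd.
  by apply/interiorS/closureS; exact: subIsetr.
by rewrite -setI_bigcupr; apply/esym/setIidPl/finite_VCdim_avoid.
Qed.

Lemma dense_setC_negligible (A : set R) :
  (@lebesgue_measure R).-negligible A -> dense (~` A).
Proof.
move=> /negligible_outer_measure A0 U [x Ux] oU; apply: contrapT => UA.
have [e /= e0 eU] : exists2 e : R, 0 < e & ball x e `<=` U.
  by apply/nbhs_ballP; exact: open_nbhs_nbhs.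
have eA : ball x e `<=` A.
  by move=> y /eU Uy; apply: contrapT => Ay; apply: UA; exists y.
have : (lebesgue_measure (ball x e) <= 0)%E.
  by rewrite -[leRHS]A0; exact: le_outer_measure.
by rewrite lebesgue_measure_ball ?(ltW e0)// lee_fin leNgt pmulrn_lgt0// e0.
Qed.

Lemma dense_finite_VCdim : dense V.
Proof.
move=> U U0 oU.
have [s [j [m cell]]] := @open_contains_cell R 2 U isT oU U0.
have p2 n : 0 < 2 ^+ n :> R by rewrite exprn_gt0.
(* A signed left endpoint: its digits vanish from index [lead_exp r + j.+1] on. *)
pose r : R := (-1) ^+ s * (m%:R / 2 ^+ j).
exists r; split; first by apply: cell; rewrite divfK ?gt_eqF// lexx lerDl/=.
apply/finite_VCdimP; exists (lead_exp r + j.+1)%N => e.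
apply: shattered_size_finite_support => i /subnK <-.
set n := (i - _)%N.
have -> : (n + (lead_exp r + j.+1) = lead_exp r + (j + n.+1))%N by lia.
rewrite base2_shift normrMsign ger0_norm ?divr_ge0 ?(ltW (p2 _))//.
rewrite exprD mulrA divfK ?gt_eqF// -natrX -natrM natrK.
by rewrite oddM oddX/= andbF.
Qed.

(** Otherwise the whole line would be null, and its empty complement dense. *)
Lemma uncountable_setC_negligible (A : set R) :
  (@lebesgue_measure R).-negligible A -> ~ countable (~` A).
Proof.
move=> A0 /countable_lebesgue_measure0 /negligible_outer_measure CA0.
have := dense_setC_negligible _ (negligibleU A0 CA0).
by rewrite setUv setCT; exact: dense0.
Qed.

Lemma uncountable_finite_VCdim : ~ countable V.
Proof.
move=> /countable_injP[f finj].
(* Diagonal string: it differs from each [r] in [V] at index [2 ^ f r] and is zero off the powers of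
   2. *)
pose b i := `[< exists r, [/\ V r, i = (2 ^ f r)%N & ~~ base2 r i] >].
have b2 i : b i -> exists k, i = (2 ^ k)%N.
  by move=> /asboolP[r [_ -> _]]; exists (f r).
have [|r /funext rb] := @exists_base2 R b.
  (* An odd number above 1 is not a power of 2, so zeros recur forever. *)
  move=> n; exists (n.*2 + 3)%N; first by lia.
  by apply/negP => /b2[[|k]]; rewrite ?expnS; lia.
have Vr : V r.
  apply/finite_VCdimP; exists 2%N => e.
  by rewrite rb; exact: shattered_size_powers2.
have [br|/negP br] := boolP (b (2 ^ f r)%N).
  have /asboolP[r' [Vr' /eqP]] := br; rewrite eqn_exp2l// => /eqP ff.
  have <- : r = r' by apply: finj; rewrite ?inE.
  by rewrite rb br.
by apply: (br); apply/asboolP; exists r; split=> //; rewrite rb; apply/negP.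
Qed.

End finite_VCdim_size.

Theorem theorem4 (R : realType) :
  let V : set R := finite_VCdim R in
  ~ closed V /\
  ~ open V /\
  (dense V /\ dense (~` V)) /\
  (~ countable V /\ ~ countable (~` V)) /\
  ((wlength idfun)^*%mu.-cara.-measurable V /\
   completed_lebesgue_measure V = 0%E) /\
  meagre V.
Proof.
move=> V.
have V0 : lebesgue_measure.-negligible V := negligible_finite_VCdim.
have dV : dense V := dense_finite_VCdim.
have dCV : dense (~` V) := dense_setC_negligible V V0.
have nonempty (A : set R) : dense A -> A !=set0.
  move=> dA; have [|x [_ Ax]] := dA setT _ openT; first by exists 0.
  by exists x.
split.
  by move=> /closed_openC oV; have [x []] := dV _ (nonempty _ dCV) oV.
split; first by move=> oV; have [x []] := dCV _ (nonempty _ dV) oV.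
split; first by split.
split.
  by split; [exact: uncountable_finite_VCdim|exact: uncountable_setC_negligible].
split; last exact: meagre_finite_VCdim.
have muV : (wlength idfun)^*%mu V = 0%E by apply/negligible_outer_measure.
split; last exact: muV.
(* A set of outer measure 0 splits every [X] additively: its trace on [X] has outer measure 0. *)
apply: le_caratheodory_measurable => X.
rewrite [X in (X + _)%E](_ : _ = 0%E); last first.
  by apply/eqP; rewrite eq_le outer_measure_ge0 andbT -muV le_outer_measure.
by rewrite add0e le_outer_measure.
Qed.
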